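(* Let $Q$ be a (finite) Moufang loop of odd order whose inner mapping group $\mathrm{Inn}(Q)$ is abelian. Then $Q$ is nilpotent of nilpotency class at most $2$.
   Context: A loop is a set $Q$ with a binary operation (written as juxtaposition) and a two-sided neutral element $1$ such that all left translations $L_x:Q\to Q$, $yL_x=xy$, and all right translations $R_x:Q\to Q$, $yR_x=yx$, are bijections. Mappings are written on the right of their arguments and composed from left to right. The inner mapping group $\mathrm{Inn}(Q)$ is the permutation group on $Q$ generated by all $T(x)=R_xL_x^{-1}$, $L(x,y)=L_xL_yL_{yx}^{-1}$ and $R(x,y)=R_xR_yR_{xy}^{-1}$ with $x,y\in Q$. The center is $Z(Q)=\{x\in Q : x\varphi=x \text{ for every } \varphi\in\mathrm{Inn}(Q)\}$. The iterated centra are $Z_0(Q)=1$, $Z_{i+1}(Q)/Z_i(Q)=Z(Q/Z_i(Q))$, and $Q$ is nilpotent of class $m$ if $m$ is the least integer with $Z_m(Q)=Q$. A loop is Moufang if it satisfies the identity $x(y(xz))=((xy)x)z$. *)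

(* Defs.v *)
From HB Require Import structures.
From mathcomp Require Import all_boot fingroup perm.

Set Implicit Arguments.
Unset Strict Implicit.
Unset Printing Implicit Defensive.

Local Open Scope group_scope.

Reserved Notation "x ** y" (at level 40, left associativity).

(* The interface is independent of the magmaType hierarchy of MathComp, in which
   no join with finType can be declared below finStarMonoidType. *)
HB.mixin Record isLoop Q := {
  lmul : Q -> Q -> Q;
  lone : Q;
  lmul1 : left_id lone lmul;
  lmulr1 : right_id lone lmul;
  ltrans_bij : forall x, bijective (fun y => lmul x y);
  rtrans_bij : forall x, bijective (fun y => lmul y x)
}.

#[short(type="loopType")]
HB.structure Definition Loop := {Q of isLoop Q}.

#[short(type="finLoopType")]
HB.structure Definition FinLoop := {Q of Loop Q & Finite Q}.

Notation "x ** y" := (lmul x y) : group_scope.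

Definition moufang (Q : loopType) : Prop :=
  forall x y z : Q, x ** (y ** (x ** z)) = ((x ** y) ** x) ** z.

Lemma fin_surj_bij (T : finType) (f : T -> T) :
  (forall v, exists u, v = f u) -> bijective f.
Proof.
move=> fs; apply: injF_bij; apply/injectiveP/card_uniqP.
rewrite size_map -cardE; apply: eq_card => v.
by have [u ->] := fs v; rewrite codom_f !inE.
Qed.

Section InnerMappings.

Variable Q : finLoopType.
Implicit Types x y z : Q.

Definition ltrans x : {perm Q} := perm (bij_inj (ltrans_bij x)).
Definition rtrans x : {perm Q} := perm (bij_inj (rtrans_bij x)).

(* Products of permutations compose from left to right: (s * t) x = t (s x). *)
Definition innT x : {perm Q} := rtrans x * (ltrans x)^-1.
Definition innL x y : {perm Q} := ltrans x * ltrans y * (ltrans (y ** x))^-1.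
Definition innR x y : {perm Q} := rtrans x * rtrans y * (rtrans (x ** y))^-1.

Definition Inn : {group {perm Q}} :=
  <<[set innT x | x : Q] :|: [set innL x y | x : Q, y : Q]
      :|: [set innR x y | x : Q, y : Q]>>%G.

Definition loop_center : {set Q} :=
  [set x | [forall phi : {perm Q}, (phi \in Inn) ==> (phi x == x)]].

(* As Q is finite, a subset containing 1 and closed under multiplication is
   closed under both divisions, hence a subloop. *)
Record normal_subloop := NormalSubloop {
  nsub_set :> {set Q};
  nsub1 : lone \in nsub_set;
  nsubM : {in nsub_set &, forall x y, x ** y \in nsub_set};
  nsubI : {in Inn & nsub_set, forall (phi : {perm Q}) x, phi x \in nsub_set}
}.

Lemma ltransE x y : ltrans x y = x ** y. Proof. by rewrite permE. Qed.
Lemma rtransE x y : rtrans x y = y ** x. Proof. by rewrite permE. Qed.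
Lemma lmulI x : injective (fun y : Q => x ** y).
Proof. exact: bij_inj (ltrans_bij x). Qed.
Lemma rmulI x : injective (fun y : Q => y ** x).
Proof. exact: bij_inj (rtrans_bij x). Qed.

Lemma innT_in x : innT x \in Inn.
Proof. by apply/mem_gen/setUP; left; apply/setUP; left; apply: imset_f. Qed.
Lemma innL_in x y : innL x y \in Inn.
Proof. by apply/mem_gen/setUP; left; apply/setUP; right; apply: imset2_f. Qed.
Lemma innR_in x y : innR x y \in Inn.
Proof. by apply/mem_gen/setUP; right; apply: imset2_f. Qed.

Lemma innTE x z : x ** innT x z = z ** x.
Proof. by rewrite /innT permM -[RHS]rtransE -ltransE permKV. Qed.
Lemma innLE x y z : (y ** x) ** innL x y z = y ** (x ** z).
Proof. by rewrite /innL !permM -ltransE permKV !ltransE. Qed.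
Lemma innRE x y z : innR x y z ** (x ** y) = (z ** x) ** y.
Proof. by rewrite /innR !permM -(rtransE (x ** y)) permKV !rtransE. Qed.

Lemma Inn_ind (P : {perm Q} -> Prop) :
    P 1 -> (forall s t, P s -> P t -> P (s * t)) ->
    (forall x, P (innT x)) -> (forall x y, P (innL x y)) ->
    (forall x y, P (innR x y)) ->
  forall phi, phi \in Inn -> P phi.
Proof.
move=> P1 PM PT PL PR phi /gen_prodgP[n [c cP ->]].
elim/big_ind: _ => // i _; case/setUP: (cP i) => [/setUP[] | ].
- by case/imsetP=> x _ ->.
- by case/imset2P=> x y _ _ ->.
- by case/imset2P=> x y _ _ ->.
Qed.

Lemma loop_centerP x :
  reflect (forall phi, phi \in Inn -> phi x = x) (x \in loop_center).
Proof.
rewrite inE; apply: (iffP forallP) => [h phi phiI | h phi].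
  by apply/eqP; move/implyP: (h phi); apply.
by apply/implyP=> phiI; apply/eqP/h.
Qed.

Lemma Inn1 phi : phi \in Inn -> phi lone = lone.
Proof.
elim/Inn_ind: phi /.
- by rewrite perm1.
- by move=> s t s1 t1; rewrite permM s1.
- by move=> y; apply: (@lmulI y); rewrite innTE lmul1 lmulr1.
- by move=> y z; apply: (@lmulI (z ** y)); rewrite innLE !lmulr1.
- by move=> y z; apply: (@rmulI (y ** z)); rewrite innRE !lmul1.
Qed.

Lemma loop_center1 : lone \in loop_center.
Proof. exact/loop_centerP/Inn1. Qed.

Lemma loop_centerM : {in loop_center &, forall x y, x ** y \in loop_center}.
Proof.
move=> a b /loop_centerP aZ /loop_centerP bZ.
have cT w z : (forall phi, phi \in Inn -> phi z = z) -> z ** w = w ** z.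
  by move=> zZ; rewrite -innTE zZ ?innT_in.
have cL u v z : (forall phi, phi \in Inn -> phi z = z) ->
    u ** (v ** z) = (u ** v) ** z.
  by move=> zZ; rewrite -innLE zZ ?innL_in.
have cR u v z : (forall phi, phi \in Inn -> phi z = z) ->
    (z ** u) ** v = z ** (u ** v).
  by move=> zZ; rewrite -innRE zZ ?innR_in.
apply/loop_centerP=> phi; elim/Inn_ind: phi /.
- by rewrite perm1.
- by move=> s t sE tE; rewrite permM sE.
- move=> w; apply: (@lmulI w); rewrite innTE.
  by rewrite (cL w a b) // -(cT w a) // (cR w b a) // -(cT w b) // (cR b w a).
- move=> u v; apply: (@lmulI (v ** u)); rewrite innLE.
  by rewrite (cL u a b) // (cL v _ b) // (cL v u a) // (cL _ a b).
- move=> u v; apply: (@rmulI (u ** v)); rewrite innRE.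
  by rewrite (cR b u a) // (cR _ v a) // (cR u v b) // (cR b _ a).
Qed.

Lemma lone_nsub_subproof : lone \in [set lone : Q].
Proof. exact: set11. Qed.

Lemma lone_nsubM_subproof : {in [set lone : Q] &, forall x y, x ** y \in [set lone : Q]}.
Proof. by move=> x y /set1P-> /set1P->; rewrite lmul1 set11. Qed.

Lemma lone_nsubI_subproof :
  {in Inn & [set lone : Q], forall (phi : {perm Q}) x, phi x \in [set lone : Q]}.
Proof. by move=> phi x phiI /set1P->; rewrite Inn1 ?set11. Qed.

Definition trivial_subloop : normal_subloop :=
  NormalSubloop lone_nsub_subproof lone_nsubM_subproof lone_nsubI_subproof.

Section Cosets.

Variable N : normal_subloop.

Definition lcoset_of x : {set Q} := [set x ** n | n in N].
Definition lcosets_of : {set {set Q}} := [set lcoset_of x | x : Q].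

Lemma nsub_bij (f : Q -> Q) :
  injective f -> (forall n, n \in N -> f n \in N) ->
  forall m, m \in N -> exists2 n, n \in N & m = f n.
Proof.
move=> fI fN m; suff fE : f @: N = N.
  by rewrite -{1}fE => /imsetP[n nN ->]; exists n.
apply/eqP; rewrite eqEcard card_imset // leqnn andbT.
by apply/subsetP=> _ /imsetP[n nN ->]; apply: fN.
Qed.

Lemma nsub_inn (phi : {perm Q}) m : phi \in Inn -> m \in N ->
  exists2 n, n \in N & m = phi n.
Proof.
by move=> pI; apply: nsub_bij => [|n nN]; [apply: perm_inj | apply: nsubI].
Qed.

Lemma lcoset_mulP x y n m : n \in N -> m \in N ->
  exists2 k, k \in N & (x ** n) ** (y ** m) = (x ** y) ** k.
Proof.
move=> nN mN.
have lE : (x ** n) ** (y ** m) = ((x ** n) ** y) ** innL y (x ** n) m.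
  by rewrite innLE.
have k1N := nsubI (innL_in y (x ** n)) mN.
rewrite lE; move: (innL _ _ m) k1N => k1 k1N.
have [n' n'N ->] := nsub_inn (innT_in x) nN; rewrite innTE.
rewrite -(innRE x y n'); have := nsubI (innR_in x y) n'N.
move: (innR _ _ n') => n2 n2N.
rewrite -(innTE (x ** y) n2); have := nsubI (innT_in (x ** y)) n2N.
move: (innT _ n2) => n3 n3N.
have [k2 k2N ->] := nsub_inn (innL_in n3 (x ** y)) k1N.
by rewrite innLE; exists (n3 ** k2) => //; apply: nsubM.
Qed.

Lemma lcoset_mem x : x \in lcoset_of x.
Proof. by apply/imsetP; exists lone; rewrite ?lmulr1 ?nsub1. Qed.

Lemma lcoset_sub x y : y \in lcoset_of x -> lcoset_of y = lcoset_of x.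
Proof.
case/imsetP=> n nN ->; apply/eqP.
rewrite eqEcard !card_imset ?leqnn ?andbT; try exact: lmulI.
apply/subsetP=> _ /imsetP[m mN ->]; apply/imsetP.
have [k kN ->] := nsub_inn (innL_in n x) mN.
by rewrite innLE; exists (n ** k) => //; apply: nsubM.
Qed.

Lemma lcoset_mul x y :
  [set a ** b | a in lcoset_of x, b in lcoset_of y] = lcoset_of (x ** y).
Proof.
apply/eqP; rewrite eqEsubset; apply/andP; split.
  apply/subsetP=> _ /imset2P[_ _ /imsetP[n nN ->] /imsetP[m mN ->] ->].
  by have [k kN ->] := lcoset_mulP x y nN mN; apply: imset_f.
apply/subsetP=> _ /imsetP[n nN ->].
have [k kN ->] := nsub_inn (innL_in y x) nN; rewrite innLE.
by apply: imset2_f; rewrite ?lcoset_mem ?imset_f.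
Qed.

Record loop_quotient := LoopCoset {
  coset_set :> {set Q};
  coset_setP : coset_set \in lcosets_of
}.

HB.instance Definition _ := [isSub for coset_set].
HB.instance Definition _ := [Finite of loop_quotient by <:].

Lemma lcoset_in x : lcoset_of x \in lcosets_of.
Proof. exact: imset_f. Qed.

Definition loop_coset x : loop_quotient := LoopCoset (lcoset_in x).

Lemma quo_mul_subproof (A B : loop_quotient) :
  [set a ** b | a in (A : {set Q}), b in (B : {set Q})] \in lcosets_of.
Proof.
case: A B => [_ /= /imsetP[x _ ->]] [_ /= /imsetP[y _ ->]].
by rewrite lcoset_mul lcoset_in.
Qed.

Definition quo_mul (A B : loop_quotient) : loop_quotient :=
  LoopCoset (quo_mul_subproof A B).

Lemma loop_coset_surj (A : loop_quotient) : exists x, A = loop_coset x.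
Proof.
by case: A => A AP; have /imsetP[x _ Ax] := AP; exists x; apply: val_inj.
Qed.

Lemma quo_mulE x y :
  quo_mul (loop_coset x) (loop_coset y) = loop_coset (x ** y).
Proof. by apply: val_inj; rewrite /= lcoset_mul. Qed.

Lemma quo_mul1 : left_id (loop_coset lone) quo_mul.
Proof. by move=> A; have [x ->] := loop_coset_surj A; rewrite quo_mulE lmul1. Qed.

Lemma quo_mulr1 : right_id (loop_coset lone) quo_mul.
Proof. by move=> A; have [x ->] := loop_coset_surj A; rewrite quo_mulE lmulr1. Qed.

Lemma quo_ltrans_bij A : bijective (fun B => quo_mul A B).
Proof.
have [x ->] := loop_coset_surj A; apply: fin_surj_bij => C.
have [z ->] := loop_coset_surj C; have [g _ gK] := ltrans_bij x.
by exists (loop_coset (g z)); rewrite quo_mulE gK.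
Qed.

Lemma quo_rtrans_bij A : bijective (fun B => quo_mul B A).
Proof.
have [x ->] := loop_coset_surj A; apply: fin_surj_bij => C.
have [z ->] := loop_coset_surj C; have [g _ gK] := rtrans_bij x.
by exists (loop_coset (g z)); rewrite quo_mulE gK.
Qed.

HB.instance Definition _ :=
  isLoop.Build loop_quotient quo_mul1 quo_mulr1 quo_ltrans_bij quo_rtrans_bij.

Lemma loop_cosetM x y : loop_coset (x ** y) = loop_coset x ** loop_coset y.
Proof. by rewrite -quo_mulE. Qed.

End Cosets.

End InnerMappings.

Arguments loop_center : clear implicits.
Arguments normal_subloop : clear implicits.
Arguments trivial_subloop : clear implicits.
Arguments Inn : clear implicits.

Section PreimCenter.

Variables (Q : finLoopType) (N : normal_subloop Q).

Local Notation pi := (@loop_coset Q N).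

Definition preim_center_set : {set Q} :=
  [set x | pi x \in loop_center (loop_quotient N)].

Lemma Inn_coset (phi : {perm Q}) : phi \in Inn Q ->
  exists2 psi, psi \in Inn (loop_quotient N) & forall x, pi (phi x) = psi (pi x).
Proof.
elim/Inn_ind: phi /.
- by exists 1; rewrite ?group1 // => x; rewrite !perm1.
- move=> s t [s' s'I sE] [t' t'I tE]; exists (s' * t'); first exact: groupM.
  by move=> x; rewrite !permM tE sE.
- move=> y; exists (innT (pi y)); first exact: innT_in.
  by move=> x; apply: (@lmulI _ (pi y)); rewrite innTE -!loop_cosetM innTE.
- move=> y z; exists (innL (pi y) (pi z)); first exact: innL_in.
  move=> x; apply: (@lmulI _ (pi z ** pi y)).
  by rewrite innLE -!loop_cosetM innLE.
- move=> y z; exists (innR (pi y) (pi z)); first exact: innR_in.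
  move=> x; apply: (@rmulI _ (pi y ** pi z)).
  by rewrite innRE -!loop_cosetM innRE.
Qed.

Lemma mem_preim_center x :
  (x \in preim_center_set) = (pi x \in loop_center (loop_quotient N)).
Proof. by rewrite in_set. Qed.

Lemma preim_center1 : lone \in preim_center_set.
Proof. by rewrite mem_preim_center; apply: loop_center1. Qed.

Lemma preim_centerM :
  {in preim_center_set &, forall x y, x ** y \in preim_center_set}.
Proof.
by move=> x y; rewrite !mem_preim_center loop_cosetM; apply: loop_centerM.
Qed.

Lemma preim_centerI : {in Inn Q & preim_center_set,
  forall (phi : {perm Q}) x, phi x \in preim_center_set}.
Proof.
move=> phi x phiI; rewrite !mem_preim_center => xZ.
have [psi psiI ->] := Inn_coset phiI.
by rewrite (loop_centerP _ xZ).
Qed.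

Definition preim_center : normal_subloop Q :=
  NormalSubloop preim_center1 preim_centerM preim_centerI.

End PreimCenter.

Fixpoint iter_center (Q : finLoopType) (i : nat) : normal_subloop Q :=
  if i is j.+1 then preim_center (iter_center Q j) else trivial_subloop Q.

Lemma iter_center_quotient (Q : finLoopType) (i : nat) :
  [set loop_coset (iter_center Q i) x | x in iter_center Q i.+1] =
  loop_center (loop_quotient (iter_center Q i)).
Proof.
apply/setP=> A; apply/imsetP/idP => [[x xZ ->]|AZ]; first by rewrite -mem_preim_center.
by have [x Ax] := loop_coset_surj A; exists x; rewrite // mem_preim_center -Ax.
Qed.

Definition nilpotent_of_class (Q : finLoopType) (m : nat) : Prop :=
  iter_center Q m = [set: Q] :> {set Q} /\
  (forall k, iter_center Q k = [set: Q] :> {set Q} -> m <= k).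

(* Main.v *)
Require Import Defs.
From HB Require Import structures.
From mathcomp Require Import all_boot fingroup perm morphism action.
From mathcomp Require Import cyclic pgroup sylow.

(** Let H be the inner mapping group, written with maps composed from left to
right, let L and R be the translations and T x = R x * (L x)^-1.

Elements of H are semi-automorphisms, so f in H with f x = x commutes with
L x * R x.  As H is abelian, f also commutes with T x, hence with the square of
L x, hence with L x itself because L x has odd order (Inn_fix_L).  So the fixed
points of every inner mapping form a subloop, and strong consequences follow.
The mapping lam x y = R y * R x * (R (yx))^-1 is the commutator of L x and R y
(ltrans_rtrans); it commutes with the translations by x and y, so it is
alternating and multiplicative in powers.  Commutativity of H further
gives lam x [x, y] = 1 and T [x, y] = lam x y ^+ 6 (lam_commr, innT_of_comm).

The center is not trivial (center_nontrivial).  If z has prime order p, then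
the p-th power of each inner mapping fixes z.  Hence H acts as a p-group on the
subloop of points fixed by the stabilizer of z in H, whose order is divisible by
p; the fixed points of that action are central.

By induction on the order, the loop modulo its center Z has class at most two.
Then displacements x^-1 (f x) with f in H lie in the second center, and
associators with elements of it are additive (lam_mull_Z2).  All obstructions
but one are killed by the same remark: a function of three arguments
alternating under one transposition and symmetric under another equals its own
inverse (alternating_symmetric), hence is trivial in the absence of 2-torsion.
The symmetry always comes from two inner mappings commuting.  For T x and T y it
shows that triple commutators vanish (comm_comm), so that lam x y ^+ 3 = 1 and
each T x is an automorphism.  For T z and lam x y it shows that commutators
associate with everything, hence are central (comm_cen).  Then every
f = lam u v is an automorphism, and for f and lam x y the remark shows that the
displacements by f associate with everything (lam_delta_eq1).  They also commute
with everything, because f commutes with T x and so T (f x) = T x (innT_delta).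
So the class is at most two. *)

Set Implicit Arguments.
Unset Strict Implicit.
Unset Printing Implicit Defensive.

Local Open Scope group_scope.

(** The associator of x and y as a permutation.  The definition is locked
because rewriting with product lemmas would otherwise see through it, an inner
mapping being a product of translations. *)
HB.lock Definition lam (Q : finLoopType) (x y : Q) : {perm Q} := innR y x.

(** * Permutation groups and symmetry of functions *)

Lemma perm_pgroup (S : finType) p (G : {group {perm S}}) :
  prime p -> {in G, forall g, g ^+ p = 1} -> p.-group G.
Proof.
move=> pP Gp; apply/pgroupP=> q qP /(Cauchy qP)[g gG oq].
by rewrite inE -dvdn_prime2 // -oq order_dvdn Gp.
Qed.

Lemma card_fix_mod (S : finType) p (G : {group {perm S}}) (W : {set S}) :
    prime p -> {in G, forall g, g ^+ p = 1} ->
    {in G & W, forall (g : {perm S}) x, g x \in W} ->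
  #|W| = #|[set x in W | [forall g in G, g x == x]]| %[mod p].
Proof.
move=> pP Gp GW; have pG := perm_pgroup pP Gp.
rewrite (@pgroup_fix_mod _ _ _ (perm_action S) p G W pG); last first.
  apply/subsetP=> g gG; rewrite !inE /=; apply/subsetP=> x xW.
  by rewrite inE /= apermE GW.
congr (_ %% _); apply: eq_card => x; rewrite in_setI in_set; congr (_ && _).
apply/afixP/forall_inP => h g gG; first by apply/eqP/h.
exact/eqP/h.
Qed.

(** All transpositions of three letters are conjugate, so F picks up the same
sign under each of them; symmetric under one, alternating under another, it
equals its own inverse.  Without 2-torsion F is then trivial, which is how triple
commutators, associators of commutators and associators of associators are
killed below. *)
Lemma alternating_symmetric (U V : Type) (i : V -> V) (F : U -> U -> U -> V) :
  involutive i ->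
  (forall x y z, F y x z = i (F x y z)) -> (forall x y z, F z y x = F x y z) ->
  forall x y z, F x y z = i (F x y z).
Proof.
move=> iK alt sym x y z.
rewrite -[LHS]sym (alt y z x) (sym x z y) (alt z x y) (sym y x z) (alt x y z).
by rewrite iK.
Qed.

Section Moufang.

Variable Q : finLoopType.
Hypothesis mfg : moufang Q.
Implicit Types (x y z u v w : Q) (f g h : {perm Q}).

Local Notation "1l" := (@lone Q).
Local Notation L := (@ltrans Q).
Local Notation R := (@rtrans Q).
Local Notation T := (@innT Q).

(** * Inverses and the Moufang identities *)

Definition linv x : Q := (L x)^-1 1l.

Lemma lmulV x : x ** linv x = 1l.
Proof. by rewrite -ltransE permKV. Qed.

Lemma flexible x y : (x ** y) ** x = x ** (y ** x).
Proof. by have := mfg x y 1l; rewrite !lmulr1. Qed.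

Lemma left_alt x z : x ** (x ** z) = (x ** x) ** z.
Proof. by have := mfg x 1l z; rewrite lmul1 lmulr1. Qed.

Lemma lmulKV x z : linv x ** (x ** z) = z.
Proof. by apply: (@lmulI _ x); rewrite mfg lmulV lmul1. Qed.

Lemma lmulVl x : linv x ** x = 1l.
Proof. by rewrite -[X in _ ** X]lmulr1 lmulKV. Qed.

Lemma linvK x : linv (linv x) = x.
Proof. by apply: (@lmulI _ (linv x)); rewrite lmulV lmulVl. Qed.

Lemma lmulK x z : x ** (linv x ** z) = z.
Proof. by rewrite -{1}(linvK x) lmulKV. Qed.

Lemma moufang_shift x a w :
  (a ** x) ** (linv x ** w) = x ** ((linv x ** a) ** w).
Proof. by rewrite -{1}(lmulK x a) -mfg lmulK. Qed.

Lemma rmulK x z : (z ** x) ** linv x = z.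
Proof. by have := moufang_shift x z 1l; rewrite !lmulr1 lmulK. Qed.

Lemma rmulKV x z : (z ** linv x) ** x = z.
Proof. by rewrite -{2}(linvK x) rmulK. Qed.

Lemma linvM x y : linv (x ** y) = linv y ** linv x.
Proof.
apply: (@rmulI _ x); rewrite rmulKV.
by rewrite -{2}(rmulK y x) lmulKV.
Qed.

Lemma linv1 : linv 1l = 1l.
Proof. by rewrite -{2}(lmulV 1l) lmul1. Qed.

Lemma linv_inj : injective linv.
Proof. exact: can_inj linvK. Qed.

Lemma middle_moufang x y z : (x ** y) ** (z ** x) = (x ** (y ** z)) ** x.
Proof.
rewrite -[RHS](rmulK (linv x ** linv z)) -mfg lmulK rmulK.
by rewrite linvM !linvK.
Qed.

Lemma right_moufang x y z :
  (y ** linv x) ** ((x ** z) ** x) = (y ** z) ** x.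
Proof.
apply: (@lmulI _ (linv (y ** linv x))); rewrite lmulKV.
by rewrite linvM linvK middle_moufang lmulKV.
Qed.

(** * Autotopisms and inner mappings *)

Definition autotopism (a b c : {perm Q}) := forall x y, a x ** b y = c (x ** y).

Lemma autotopismM a b c a' b' c' :
  autotopism a b c -> autotopism a' b' c' ->
  autotopism (a * a') (b * b') (c * c').
Proof. by move=> t t' x y; rewrite !permM t' t. Qed.

Lemma autotopismV a b c :
  autotopism a b c -> autotopism a^-1 b^-1 c^-1.
Proof.
by move=> t x y; apply: (@perm_inj _ c); rewrite permKV -t !permKV.
Qed.

Lemma autotopism_middle x : autotopism (L x) (R x) (L x * R x).
Proof. by move=> y z; rewrite permM !(ltransE, rtransE) middle_moufang. Qed.

Lemma ltransV x : L (linv x) = (L x)^-1.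
Proof.
by apply/permP=> y; apply: (@perm_inj _ (L x)); rewrite permKV !ltransE lmulK.
Qed.

Lemma ltrans_xyx x y : L ((x ** y) ** x) = L x * L y * L x.
Proof. by apply/permP=> z; rewrite !permM !ltransE mfg. Qed.

Definition lpow x n : Q := (L x ^+ n) 1l.

(** Multiplying u by x on both sides advances the exponent by two. *)
Lemma ltransX x n : L (lpow x n) = L x ^+ n.
Proof.
suff [u uE] : exists u, L u = L x ^+ n by rewrite -uE /lpow -uE ltransE lmulr1.
have [m le_nm] := ubnP n; elim: m n le_nm => // m IHm [|[|n]] le_nm.
- by exists 1l; apply/permP=> u; rewrite ltransE lmul1 expg0 perm1.
- by exists x; rewrite expg1.
have [u uE] := IHm n (ltnW le_nm); exists ((x ** u) ** x).
by rewrite ltrans_xyx uE -mulgA -expgSr -expgS.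
Qed.

Lemma rtransV x : R (linv x) = (R x)^-1.
Proof.
by apply/permP=> y; apply: (@perm_inj _ (R x)); rewrite permKV !rtransE rmulKV.
Qed.

Lemma autotopism_right x : autotopism (R x)^-1 (L x * R x) (R x).
Proof.
by move=> y z; rewrite -rtransV permM !(ltransE, rtransE) right_moufang.
Qed.

Definition pseudo_aut f c := forall x y, f x ** (f y ** c) = f (x ** y) ** c.

(** The usual description of a pseudo-automorphism: the other two components of
an autotopism that fixes 1 in its first one are f followed by the right
translation by the companion. *)
Lemma autotopism_pseudo f b c :
  autotopism f b c -> f 1l = 1l -> pseudo_aut f (b 1l).
Proof.
move=> t f1.
have bc y : b y = c y by rewrite -[in RHS](lmul1 y) -t f1 lmul1.
have cE x : f x ** b 1l = c x by rewrite t lmulr1.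
by move=> x y; rewrite !cE -bc t.
Qed.

Definition comm x y : Q := linv (y ** x) ** (x ** y).

(** The companion of innR x y matters later: when the commutator of x and y is
central, innR x y is an automorphism. *)
Lemma autotopism_innR x y : exists2 b : {perm Q}, b 1l = comm x y &
  exists c, autotopism (innR x y) b c.
Proof.
have t z := autotopismV (autotopism_right z).
have := autotopismM (autotopismM (t x) (t y)) (autotopism_right (x ** y)).
rewrite !invgK => tE; eexists; last by eexists; apply: tE.
have e : autotopism (innR x y) _ _ := tE.
have := e 1l 1l; rewrite Inn1 ?innR_in // !lmul1 => ->.
by rewrite !permM -!rtransV !rtransE lmul1 /comm linvM.
Qed.

Lemma Inn_autotopism f : f \in Inn Q -> exists b c, autotopism f b c.
Proof.
elim/Inn_ind: f /.
- by exists 1, 1 => x y; rewrite !perm1.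
- move=> f g [b [c t]] [b' [c' t']].
  by exists (b * b'), (c * c'); apply: autotopismM.
- move=> x; have := autotopismM (autotopismV (autotopism_right x))
                      (autotopismV (autotopism_middle x)).
  by rewrite invgK => t; do 2!eexists; apply: t.
- move=> x y; have t := autotopismM (autotopismM (autotopism_middle x)
    (autotopism_middle y)) (autotopismV (autotopism_middle (y ** x))).
  by do 2!eexists; apply: t.
- by move=> x y; have [b _ [c t]] := autotopism_innR x y; exists b, c.
Qed.

Lemma Inn_pseudo f : f \in Inn Q -> exists c, pseudo_aut f c.
Proof.
move=> fI; have [b [c t]] := Inn_autotopism fI.
by exists (b 1l); apply: autotopism_pseudo t (Inn1 fI).
Qed.

Lemma pseudo_innR x y : pseudo_aut (innR x y) (comm x y).
Proof.
have [b <- [c t]] := autotopism_innR x y.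
by apply: autotopism_pseudo t (Inn1 (innR_in x y)).
Qed.

Lemma Inn_linv f x : f \in Inn Q -> f (linv x) = linv (f x).
Proof.
move=> fI; have [c fc] := Inn_pseudo fI; apply: (@rmulI _ c).
by apply: (@lmulI _ (f x)); rewrite /= fc lmulV Inn1 // lmul1 lmulK.
Qed.

(** Moving the companion to the left factor turns the identity of a
pseudo-automorphism into one where the companions cancel by the middle Moufang
identity. *)
Lemma Inn_xyx f x y :
  f \in Inn Q -> f ((x ** y) ** x) = (f x ** f y) ** f x.
Proof.
move=> fI; have [c fc] := Inn_pseudo fI.
(* The companion on the left factor, its inverse on the right one. *)
have fc' u v : f (u ** v) = (f u ** c) ** (linv c ** f v).
  have := fc (u ** v) (linv v); rewrite rmulK => <-.
  by rewrite -[LHS](rmulK (f (linv v) ** c)) linvM Inn_linv // linvK.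
by rewrite fc' -fc middle_moufang rmulK.
Qed.

Definition linv_perm : {perm Q} := perm linv_inj.

Lemma linv_permV : linv_perm^-1 = linv_perm.
Proof.
by apply/permP=> y; apply: (@perm_inj _ linv_perm); rewrite permKV !permE linvK.
Qed.

(** Conjugation by inversion exchanges left and right translations and, by
Inn_J, fixes the inner mappings; it yields the mirror image of every identity
between translations. *)
Lemma ltrans_J x : L x ^ linv_perm = (R x)^-1.
Proof.
apply/permP=> y; rewrite -rtransV /conjg linv_permV !permM !permE.
by rewrite linvM linvK.
Qed.

Lemma rtrans_J x : R x ^ linv_perm = (L x)^-1.
Proof.
apply/permP=> y; rewrite -ltransV /conjg linv_permV !permM !permE.
by rewrite linvM linvK.
Qed.

Lemma Inn_J f : f \in Inn Q -> f ^ linv_perm = f.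
Proof.
move=> fI; apply/permP=> y; rewrite /conjg linv_permV !permM !permE.
by rewrite Inn_linv // linvK.
Qed.

(** * Orders of left translations *)

(** The powers of x act on W without fixed points, so the orbits of the cyclic
group generated by the left translation all have length p. *)
Lemma card_semireg p x (W : {set Q}) : prime p -> x != 1l -> L x ^+ p = 1 ->
  (forall u, u \in W -> x ** u \in W) -> p %| #|W|.
Proof.
move=> pP x1 Lp xW.
have Gp : {in <[L x]>, forall g, g ^+ p = 1}.
  by move=> _ /cycleP[i ->]; rewrite -expgM mulnC expgM Lp expg1n.
have GW : {in <[L x]> & W, forall (g : {perm Q}) u, g u \in W}.
  move=> _ u /cycleP[i ->] uW; rewrite permX.
  by elim: i => //= i IHi; rewrite ltransE xW.
rewrite /dvdn (card_fix_mod pP Gp GW) (_ : [set _ in _ | _] = set0);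
  first by rewrite cards0 mod0n.
apply/setP=> u; rewrite !inE; apply/negP=> /andP[_ /forall_inP/(_ (L x))].
rewrite cycle_id => /(_ isT)/eqP; rewrite ltransE -{2}(lmul1 u) => /rmulI e.
by rewrite e eqxx in x1.
Qed.

Lemma loop_Cauchy p x : prime p -> p %| #[L x] ->
  exists2 z, z != 1l & L z ^+ p = 1.
Proof.
move=> pP /dvdnP[m mE]; exists (lpow x m); last first.
  by rewrite ltransX -expgM -mE expg_order.
have m0 : 0 < m by have := order_gt0 (L x); rewrite mE muln_gt0 => /andP[].
apply/eqP=> e; have := ltransX x m; rewrite e.
have -> : L 1l = 1 by apply/permP=> u; rewrite ltransE lmul1 perm1.
move/esym/eqP; rewrite -order_dvdn mE => /(dvdn_leq m0).
by rewrite -{2}(muln1 m) leq_pmul2l // leqNgt prime_gt1.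
Qed.

Lemma odd_ltrans x : odd #|Q| -> odd #[L x].
Proof.
move=> oQ; apply/negP => /negP; rewrite -dvdn2 => /(@loop_Cauchy 2 _ isT)[z z1 Lz].
suff : 2 %| #|Q| by rewrite dvdn2 oQ.
rewrite -cardsT; by apply: (@card_semireg 2 z) => // u _; rewrite inE.
Qed.

Hypothesis oddQ : forall x, odd #[L x].
Hypothesis abH : abelian (Inn Q).

(** * Fixed points of commuting inner mappings *)

Lemma InnC f g : f \in Inn Q -> g \in Inn Q -> commute f g.
Proof. by move=> fI gI; apply: (centsP abH). Qed.

Lemma Inn_conj f g : f \in Inn Q -> g \in Inn Q -> f ^ g = f.
Proof. by move=> fI gI; rewrite conjgE (InnC fI gI) mulKg. Qed.

Lemma commute_LR x : commute (L x) (R x).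
Proof.
by apply/permP=> y; rewrite !permM !(ltransE, rtransE) flexible.
Qed.

(** The key consequence of commuting inner mappings.  As f is a
semi-automorphism fixing x, it commutes with the product of the two
translations by x; it also commutes with T x.  The square of the left
translation by x is a product of these two, and odd order recovers the
translation from its square.  Hence the fixed points of any inner mapping form
a subloop over which the mapping is linear. *)
Lemma Inn_fix_L f x : f \in Inn Q -> f x = x -> commute f (L x).
Proof.
move=> fI fx.
have fP : commute f (L x * R x).
  by apply/permP=> y; rewrite !permM !(ltransE, rtransE) Inn_xyx // fx.
have fL2 : commute f (L x ^+ 2).
  have -> : L x ^+ 2 = (T x)^-1 * (L x * R x).
    by rewrite invMg invgK commute_LR mulgA mulgKV.
  exact/commuteM/fP/commuteV/InnC/innT_in.
(* For n odd, L x ^+ n = 1 makes L x the (n + 1)/2-th power of its square. *)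
have -> : L x = (L x ^+ 2) ^+ (#[L x].+1)./2.
  rewrite -expgM mul2n -[X in L x ^+ X]add0n -[(_./2).*2]add0n.
  have := odd_double_half #[L x].+1; rewrite /= oddQ add0n => ->.
  by rewrite expgS expg_order mulg1.
exact: commuteX.
Qed.

Lemma Inn_fix_R f x : f \in Inn Q -> f x = x -> commute f (R x).
Proof.
move=> fI fx; have := congr1 (conjg^~ linv_perm) (Inn_fix_L fI fx).
rewrite /= !conjMg Inn_J // ltrans_J => e.
by have := commuteV e; rewrite invgK.
Qed.

Lemma Inn_fixM f x y : f \in Inn Q -> f x = x -> f (x ** y) = x ** f y.
Proof.
by move=> fI /(Inn_fix_L fI) e; rewrite -!ltransE -!permM -e.
Qed.

Lemma Inn_fixMr f x y : f \in Inn Q -> f x = x -> f (y ** x) = f y ** x.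
Proof.
by move=> fI /(Inn_fix_R fI) e; rewrite -!rtransE -!permM -e.
Qed.

Lemma Inn_fixV f x : f \in Inn Q -> f x = x -> f (linv x) = linv x.
Proof. by move=> fI fx; rewrite Inn_linv ?fx. Qed.

(** * Associator mappings *)

Lemma lam_in x y : lam x y \in Inn Q.
Proof. by rewrite lam.unlock innR_in. Qed.

Lemma lamE x y z : lam x y z ** (y ** x) = (z ** y) ** x.
Proof. by rewrite lam.unlock innRE. Qed.

Lemma lam_fixl x y : lam x y x = x.
Proof. by apply: (@rmulI _ (y ** x)); rewrite /= lamE flexible. Qed.

Lemma lam_fixr x y : lam x y y = y.
Proof. by apply: (@rmulI _ (y ** x)); rewrite /= lamE left_alt. Qed.

Lemma rtransM x y : R y * R x = lam x y * R (y ** x).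
Proof. by rewrite lam.unlock mulgKV. Qed.

(** By the middle Moufang identity the two sides differ by an inner mapping that
commutes with all the translations involved, so every pair of a left and a
right translation generates a group of class at most two. *)
Lemma ltrans_rtrans x y : L x * R y = lam x y * (R y * L x).
Proof.
have e : L x * R (y ** x) = R y * (L x * R x).
  by apply/permP=> w; rewrite !permM !(ltransE, rtransE) middle_moufang.
apply: (mulIg (R x)); rewrite -mulgA rtransM mulgA.
by rewrite -(Inn_fix_L (lam_in x y) (lam_fixl x y)) -!mulgA e.
Qed.

(** The mirror image of the commutation rule just proved is the same rule with
x and y exchanged. *)
Lemma lamV x y : lam y x = (lam x y)^-1.
Proof.
have := congr1 (conjg^~ linv_perm) (ltrans_rtrans x y).
rewrite /= !conjMg ltrans_J rtrans_J (Inn_J (lam_in x y)).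
rewrite -!invMg => /(congr1 invg); rewrite !(invMg, invgK) => e.
apply: (mulIg (R x * L y)); rewrite -ltrans_rtrans e.
apply: commuteV; apply: commute_sym; apply: commuteM.
  by apply: Inn_fix_R; rewrite ?lam_in ?lam_fixl.
by apply: Inn_fix_L; rewrite ?lam_in ?lam_fixr.
Qed.

Lemma ltransM x y : L y * L x = lam x y * L (x ** y).
Proof.
have := congr1 (conjg^~ linv_perm) (rtransM y x).
rewrite /= !conjMg !rtrans_J (Inn_J (lam_in y x)) lamV.
rewrite -!invMg => /invg_inj ->.
apply: commute_sym; apply: Inn_fix_L; first exact: lam_in.
by rewrite Inn_fixM ?lam_in ?lam_fixl ?lam_fixr.
Qed.

Lemma lam_Ll x y : commute (lam x y) (L x).
Proof. by apply: Inn_fix_L; rewrite ?lam_in ?lam_fixl. Qed.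

Lemma lam_Lr x y : commute (lam x y) (L y).
Proof. by apply: Inn_fix_L; rewrite ?lam_in ?lam_fixr. Qed.

Lemma lam_Rr x y : commute (lam x y) (R y).
Proof. by apply: Inn_fix_R; rewrite ?lam_in ?lam_fixr. Qed.

Local Notation Z := (loop_center Q).

(** * Central displacements *)

Lemma cen_fix ze f : ze \in Z -> f \in Inn Q -> f ze = ze.
Proof. by move/loop_centerP; apply. Qed.

Lemma cenC ze w : ze \in Z -> ze ** w = w ** ze.
Proof. by move=> zeZ; rewrite -(innTE w ze) (cen_fix zeZ) ?innT_in. Qed.

Lemma cen_assoc ze u v : ze \in Z -> u ** (v ** ze) = (u ** v) ** ze.
Proof. by move=> zeZ; rewrite -(innLE v u) (cen_fix zeZ) ?innL_in. Qed.

Lemma cen_swap ze u v : ze \in Z -> (u ** ze) ** v = (u ** v) ** ze.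
Proof.
move=> zeZ; have := innRE u v ze; rewrite (cen_fix zeZ) ?innR_in // => e.
by rewrite -(cenC _ zeZ) -e cenC.
Qed.

Lemma cen_RL ze w : ze \in Z -> commute (R ze) (L w).
Proof.
by move=> zeZ; apply/permP=> u; rewrite !permM !(rtransE, ltransE) cen_assoc.
Qed.

Lemma cen_RI ze f : ze \in Z -> f \in Inn Q -> commute (R ze) f.
Proof. by move=> zeZ fI; apply/commute_sym/Inn_fix_R/cen_fix. Qed.

Lemma cenV ze : ze \in Z -> linv ze \in Z.
Proof. by move=> zeZ; apply/loop_centerP=> f fI; rewrite Inn_linv ?cen_fix. Qed.

(** Both sides of the commutation rule for L x and R y, evaluated at z: the
displacement of z by lam x y is the associator of x, z and y, which is
therefore invariant under cyclic rotation as soon as it is central. *)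
Lemma lam_disp_cyc ze x y z :
  ze \in Z -> lam y z x = x ** ze -> lam x y z = z ** ze.
Proof.
move=> zeZ e; apply: (@rmulI _ y); apply: (@lmulI _ x); rewrite /=.
have := congr1 (fun f : {perm Q} => f z) (ltrans_rtrans x y).
rewrite !permM !(rtransE, ltransE) => <-.
by rewrite -lamE e !(cen_swap _ _ zeZ) (cen_assoc _ _ zeZ).
Qed.

Lemma lam_fix_cyc x y z : lam y z x = x -> lam x y z = z.
Proof.
by move=> e; rewrite (@lam_disp_cyc 1l) ?loop_center1 ?lmulr1.
Qed.

Lemma lam_fixV x y z : lam x y z = z -> lam y x z = z.
Proof. by move=> e; rewrite lamV -{1}e permK. Qed.

Lemma lam_assoc x y z : lam x y z = z -> (z ** y) ** x = z ** (y ** x).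
Proof. by rewrite -lamE => ->. Qed.

Lemma lamV_l x y : lam (linv x) y = (lam x y)^-1.
Proof.
apply: (mulIg (R y * L (linv x))); rewrite -ltrans_rtrans ltransV.
have c := commuteV (commute_sym (lam_Ll x y)).
apply: (mulgI (L x)); rewrite mulKVg !mulgA c; apply: (mulIg (L x)).
by rewrite mulgKV -mulgA ltrans_rtrans mulKg.
Qed.

Lemma lamV_r x y : lam x (linv y) = (lam x y)^-1.
Proof. by rewrite lamV lamV_l -lamV. Qed.

(** * Commutators *)

Lemma comm_inv x y : comm y x = linv (comm x y).
Proof. by rewrite /comm [in RHS]linvM linvK. Qed.

Lemma innT_conj x y : T y x = linv y ** (x ** y).
Proof. by apply: (@lmulI _ y); rewrite innTE lmulK. Qed.

(** The fixed points form a subloop containing x and y. *)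
Lemma lam_fix_comm x y : lam x y (comm x y) = comm x y.
Proof.
have lx := lam_fixl x y; have ly := lam_fixr x y; have lI := lam_in x y.
have fM u v : lam x y u = u -> lam x y v = v -> lam x y (u ** v) = u ** v.
  by move=> fu fv; rewrite Inn_fixM ?fv.
by apply/fM; [apply: Inn_fixV => //|]; apply/fM.
Qed.

Lemma innT_comm x y : T y x = x ** comm x y.
Proof.
apply: (@lmulI _ y); rewrite innTE -lam_assoc ?lmulK //.
exact/lam_fix_cyc/lam_fix_comm.
Qed.

(** * Powers *)

Lemma perm_fixX f x n : f x = x -> (f ^+ n) x = x.
Proof. by move=> fx; rewrite permX; elim: n => //= n ->. Qed.

Lemma lam_conj x y : L x ^ R y = lam x y * L x.
Proof.
apply: (mulgI (R y)); rewrite mulKVg ltrans_rtrans mulgA (lam_Rr x y).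
by rewrite mulgA.
Qed.

Lemma ltrans1 : L 1l = 1.
Proof. by apply/permP=> u; rewrite ltransE lmul1 perm1. Qed.

Lemma lam_eq1 x y : commute (L x) (R y) -> lam x y = 1.
Proof.
by move=> c; apply: (mulIg (L x)); rewrite -lam_conj conjgE c mulKg mul1g.
Qed.

Lemma lam1 y : lam 1l y = 1.
Proof. by apply: lam_eq1; rewrite ltrans1; apply: commute_sym; apply: commute1. Qed.

Lemma rtrans_ltrans x : R x = (L x ^ linv_perm)^-1.
Proof. by rewrite ltrans_J invgK. Qed.

Lemma rtransX x n : R (lpow x n) = R x ^+ n.
Proof. by rewrite rtrans_ltrans ltransX conjXg ltrans_J expgVn invgK. Qed.

(** The commutator of L x and R y commutes with L x, so it is multiplicative in
powers of x.  In particular its order divides the order of x, hence is odd. *)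
Lemma lamX x y n : lam (lpow x n) y = lam x y ^+ n.
Proof.
apply: (mulIg (L x ^+ n)); rewrite -ltransX -lam_conj ltransX conjXg lam_conj.
by rewrite expgMn //; apply: lam_Ll.
Qed.

Lemma innTX x n : T (lpow x n) = T x ^+ n.
Proof.
rewrite /innT rtransX ltransX -expgVn expgMn //.
exact/commuteV/commute_sym/commute_LR.
Qed.

Lemma lam_sq1 x y : lam x y ^+ 2 = 1 -> lam x y = 1.
Proof.
move=> e; have := lamX x y #[L x]; rewrite /lpow expg_order perm1 lam1.
rewrite -[#[L x]]odd_double_half oddQ -mul2n expgD expgM e expg1n mulg1.
by move/esym; rewrite expg1.
Qed.

Lemma lmul_sq1 x : x ** x = 1l -> x = 1l.
Proof.
move=> e; have L2 : L x ^+ 2 = 1.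
  by apply/permP=> u; rewrite expgS expg1 permM !ltransE left_alt e lmul1 perm1.
have := expg_order (L x).
rewrite -{1}[#[L x]]odd_double_half oddQ -mul2n expgD expgM L2 expg1n mulg1.
by move/(congr1 (fun g : {perm Q} => g 1l)); rewrite ltransE lmulr1 perm1.
Qed.

(** * Associators and commutators of two elements *)

(** T y is R y times the inverse of L y; each factor contributes one associator,
and so does splitting the left translation by y(T y x). *)
Lemma ltrans_innT x y :
  L x ^ T y = lam x y ^+ 2 * lam (T y x) y * L (T y x).
Proof.
rewrite {1}/innT conjgM lam_conj conjgE invgK.
apply: (mulIg (L y)); rewrite !mulgA mulgKV -[RHS]mulgA ltransM innTE.
rewrite (lamV (T y x)) !mulgA mulgK -(lam_Lr x y) -mulgA ltransM mulgA.
by rewrite expgS expg1.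
Qed.

Lemma rtrans_innT x y :
  R x ^ T y = R (T y x) * (lam x y ^+ 2 * lam (T y x) y)^-1.
Proof.
rewrite {1}rtrans_ltrans conjVg -{1}(Inn_J (innT_in y)) -conjJg ltrans_innT.
set c := lam x y ^+ 2 * _; rewrite (conjMg c) ltrans_J.
by rewrite Inn_J ?groupM ?groupX ?lam_in // invMg invgK.
Qed.

(** When x, y and k associate, all their associators commute with all their
translations, and the commutator of L x with a product expands bilinearly. *)
Lemma lam_mulr_assoc x y k : lam x y k = k -> lam x (y ** k) = lam x y * lam x k.
Proof.
move=> e; have e1 := lam_fix_cyc e; have e2 := lam_fix_cyc e1.
have c1 : commute (lam x k) (R y) by apply: Inn_fix_R (lam_in _ _) (lam_fixV e1).
have c2 : commute (lam k y) (L x) by apply: Inn_fix_L (lam_in _ _) (lam_fixV e2).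
apply: (mulIg (L x)); rewrite -lam_conj.
have -> : R (y ** k) = (lam k y)^-1 * (R y * R k) by rewrite rtransM mulKg.
rewrite conjgM; have -> : L x ^ (lam k y)^-1 = L x.
  by rewrite conjgE invgK mulgA c2 mulgK.
rewrite conjgM lam_conj conjMg lam_conj mulgA; congr (_ * _ * _).
by rewrite conjgE (Inn_fix_R (lam_in x y) e) mulKg.
Qed.

(** Conjugation by T x fixes both L x and lam x y, while it moves R y to the
translation by T x y up to a factor that commutes with L x. *)
Lemma lam_innT x y : lam x (T x y) = lam x y.
Proof.
have dx : (lam y x ^+ 2 * lam (T x y) x) x = x.
  by rewrite permM perm_fixX lam_fixr.
set c := (lam y x ^+ 2 * lam (T x y) x)^-1.
have cI : c \in Inn Q by rewrite groupV groupM ?groupX ?lam_in.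
have cx : commute c (L x).
  by apply: Inn_fix_L => //; rewrite -{1}dx permK.
have Lx : L x ^ T x = L x.
  by rewrite conjgE -(Inn_fix_L (innT_in x)) ?mulKg // innT_conj lmulKV.
have := congr1 (conjg^~ (T x)) (lam_conj x y).
rewrite /= (conjMg (lam x y)) conjJg Lx rtrans_innT -/c.
rewrite (Inn_conj (lam_in x y) (innT_in x)).
rewrite conjgM lam_conj (conjMg (lam _ _)) => e; apply: (mulIg (L x)); rewrite -{}e.
have -> : L x ^ c = L x by rewrite conjgE -cx mulKg.
by rewrite Inn_conj ?lam_in.
Qed.

Lemma lam_commr x y : lam x (comm y x) = 1.
Proof.
have := lam_innT x y; rewrite innT_comm lam_mulr_assoc => [/(canRL (mulKg _))|].
  by rewrite mulVg.
by rewrite comm_inv Inn_fixV ?lam_in // lam_fix_comm.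
Qed.

Lemma innTD x y : lam x y = 1 -> T (x ** y) = T x * T y.
Proof.
move=> l1.
have := rtransM y x; rewrite lamV l1 invg1 mul1g /innT => <-.
have := ltransM x y; rewrite l1 mul1g => <-.
rewrite invMg !mulgA; congr (_ * _); rewrite -!mulgA; congr (_ * _).
by have := ltrans_rtrans x y; rewrite l1 mul1g => e; apply: commuteV.
Qed.

(** The factors lam x y ^+ 3 by which conjugation by T y distorts the two
translations by x have opposite signs, so they add up in T x; but T x is fixed
by that conjugation.  Hence T (T y x) = T x * lam x y ^+ 6, where
T y x = x ** comm x y and x, comm x y have no associators. *)
Lemma innT_of_comm x y : T (comm x y) = lam x y ^+ 6.
Proof.
have lT : lam (T y x) y = lam x y by rewrite lamV lam_innT -lamV.
have := ltrans_innT x y; have := rtrans_innT x y; rewrite lT -expgSr.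
set c := lam x y ^+ 3 => eR eL.
have TT : T x ^ T y = T x by rewrite Inn_conj ?innT_in.
have cL : commute c (L (T y x)).
  by apply/commute_sym/commuteX; rewrite -lT; apply/commute_sym/lam_Ll.
have TE : T (T y x) = T x * lam x y ^+ 6.
  rewrite (expgD _ 3 3) -/c -[in RHS]TT {2}/innT (conjMg (R x)) conjVg eR eL.
  rewrite {1}/innT; move: {eR eL} (c) (L _) (R _) cL => {}c l r cl.
  by rewrite invMg !mulgA mulgKV -[RHS]mulgA -(commuteV cl) mulgA mulgKV.
apply: (mulgI (T x)); rewrite -TE -innTD ?innT_comm //.
by rewrite comm_inv lamV_r lam_commr invg1.
Qed.

(** * Nontriviality of the center *)

(** T x fixes x, hence also T y x, because T x and T y commute. *)
Lemma innT_fix_comml x y : T x (comm x y) = comm x y.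
Proof.
have Tx : T x x = x by rewrite innT_conj lmulKV.
have TI := innT_in x.
rewrite -(lmulKV x (comm x y)) -innT_comm Inn_fixM ?Inn_fixV //.
by rewrite -permM InnC ?innT_in // permM Tx.
Qed.

Lemma innT_fix_commr x y : T y (comm x y) = comm x y.
Proof. by rewrite comm_inv Inn_fixV ?innT_in ?innT_fix_comml. Qed.

Lemma innTX_fixed x y n : (T y ^+ n) x = (R (comm x y) ^+ n) x.
Proof.
have cTR : commute (T y) (R (comm x y)).
  by apply: Inn_fix_R; rewrite ?innT_in ?innT_fix_commr.
elim: n => [|n IHn]; first by rewrite !expg0.
rewrite expgSr permM IHn -permM -(commuteX n cTR) permM innT_comm.
by rewrite [in RHS]expgS permM rtransE.
Qed.

Lemma innL_lam x y : innL x y = lam y x.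
Proof. by rewrite /innL ltransM mulgK. Qed.

Lemma Inn_gen (P : {perm Q} -> Prop) :
    P 1 -> (forall f g, f \in Inn Q -> g \in Inn Q -> P f -> P g -> P (f * g)) ->
    (forall x, P (T x)) -> (forall x y, P (lam x y)) ->
  forall f, f \in Inn Q -> P f.
Proof.
move=> P1 PM PT Pl f fI; suff [] : f \in Inn Q /\ P f by [].
move: f fI; apply: Inn_ind => [|f g [fI Pf] [gI Pg]|x|x y|x y].
- by rewrite group1.
- by split; [apply: groupM | apply: PM].
- by rewrite innT_in.
- by rewrite innL_lam lam_in.
- by have := Pl y x; have := lam_in y x; rewrite lam.unlock.
Qed.

(** It suffices to check the generators, and these are multiplicative in
powers.  The p-th powers of the commutators of z are trivial together with that
of z, and lam (x^p) y fixes z because lam z (x^p) = lam (z^p) x is trivial. *)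
Lemma Inn_expp_fix p z f : L z ^+ p = 1 -> f \in Inn Q -> (f ^+ p) z = z.
Proof.
move=> Lp; have zp : lpow z p = 1l by rewrite /lpow Lp perm1.
elim/Inn_gen: f / => [|f g fI gI fz gz|x|x y].
- by rewrite expg1n perm1.
- by rewrite expgMn ?permM ?fz //; apply: InnC.
- rewrite innTX_fixed comm_inv rtransV expVgn -rtransX.
  suff -> : lpow (comm x z) p = 1l by rewrite -rtransV linv1 rtransE lmulr1.
  apply: (@lmulI _ x); rewrite -[LHS]rtransE rtransX -innTX_fixed -innTX zp.
  by rewrite lmulr1 innT_conj linv1 !lmul1 lmulr1.
- rewrite -lamX; do 2!apply: lam_fix_cyc.
  by rewrite lamV lamX lamV expVgn invgK -lamX zp lam1 perm1.
Qed.

(** Take z of prime order p and let W consist of the points fixed by every inner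
mapping that fixes z.  Since p-th powers of inner mappings fix z, they fix W
pointwise, so Inn Q acts on W as a p-group.  As W is closed under the
semiregular left translation by z, its order is divisible by p.  So 1 is not
the only fixed point, and the fixed points are central. *)
Lemma center_nontrivial x : x != 1l -> exists2 z, z \in Z & z != 1l.
Proof.
move=> x1.
have Lx1 : #[L x] != 1%N.
  rewrite order_eq1; apply/eqP=> e; case/eqP: x1.
  by rewrite -(lmulr1 x) -ltransE e perm1.
have [p pP px] : {p | prime p & p %| #[L x]}.
  by apply: pdivP; rewrite ltn_neqAle eq_sym Lx1 order_gt0.
have [z z1 Lz] := loop_Cauchy pP px.
pose W := [set u | [forall f in Inn Q, (f z == z) ==> (f u == u)]].
have WP u : reflect (forall f, f \in Inn Q -> f z = z -> f u = u) (u \in W).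
  rewrite inE; apply: (iffP forall_inP) => [h f fI /eqP fz | h f fI].
    by apply/eqP; have /implyP := h f fI; apply.
  by apply/implyP=> /eqP fz; apply/eqP/h.
have WI f u : f \in Inn Q -> u \in W -> f u \in W.
  move=> fI /WP uW; apply/WP=> g gI gz.
  by rewrite -permM (InnC fI gI) permM uW.
have Wz u : u \in W -> z ** u \in W.
  by move=> /WP uW; apply/WP=> f fI fz; rewrite Inn_fixM // uW.
have pW : p %| #|W| by apply: card_semireg pP z1 Lz Wz.
have NW f : f \in Inn Q -> f \in 'N(W | 'P).
  move=> fI; rewrite !inE /=; apply/subsetP=> u uW.
  by rewrite inE /= apermE WI.
pose G := (restr_perm W @* Inn Q)%G.
have GE f u : f \in Inn Q -> u \in W -> restr_perm W f u = f u.
  by move=> fI uW; rewrite restr_permE ?NW.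
have Gp : {in G, forall g, g ^+ p = 1}.
  move=> _ /morphimP[f fN fI ->]; rewrite -morphX //; apply/eqP.
  have : f ^+ p \in 'C(W | 'P).
    apply/astabP=> u /WP uW; rewrite /= apermE uW ?groupX //.
    exact: Inn_expp_fix.
  by rewrite -ker_restr_perm => /mker ->.
have GW : {in G & W, forall (g : {perm Q}) u, g u \in W}.
  by move=> _ u /morphimP[f fN fI ->] uW; rewrite GE ?WI.
move: pW; rewrite /dvdn (card_fix_mod pP Gp GW) -/(dvdn p _).
set F := [set _ in _ | _] => pF.
have F1 : 1l \in F.
  rewrite inE; apply/andP; split; first by apply/WP=> f fI _; rewrite Inn1.
  apply/forall_inP=> _ /morphimP[f fN fI ->]; rewrite GE ?Inn1 //.
  by apply/WP=> g gI _; rewrite Inn1.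
have : 0 < #|F :\ 1l|.
  rewrite lt0n; apply/eqP=> e; move: pF; rewrite (cardsD1 1l) F1 e addn0 dvdn1.
  by move/eqP=> e1; rewrite e1 in pP.
case/card_gt0P=> w; rewrite !inE => /and3P[w1 wW /forall_inP Fw].
exists w => //; apply/loop_centerP=> f fI; rewrite -GE ?inE //.
by apply/eqP/Fw/mem_morphim; rewrite ?NW.
Qed.

(** * The second center *)

(** Membership in the second center, expressed without the quotient loop. *)
Definition Z2 d := forall f, f \in Inn Q -> exists2 ze, ze \in Z & f d = d ** ze.

Lemma Z2_cen ze : ze \in Z -> Z2 ze.
Proof.
by move=> zeZ f fI; exists 1l; rewrite ?loop_center1 // lmulr1 cen_fix.
Qed.

Lemma Z2_lam d y w : Z2 d -> exists2 ze, ze \in Z & lam d y w = w ** ze.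
Proof.
move=> dZ; have [ze zeZ e] := dZ _ (lam_in y w).
by exists ze => //; apply: lam_disp_cyc.
Qed.

Lemma Z2_comm d y : Z2 d -> comm d y \in Z.
Proof.
move=> dZ; have [ze zeZ] := dZ _ (innT_in y).
by rewrite innT_comm => /lmulI ->.
Qed.

Lemma cen_lam ze y : ze \in Z -> lam ze y = 1.
Proof.
move=> zeZ; apply/permP=> w; rewrite perm1; apply: lam_fix_cyc.
by rewrite cen_fix ?lam_in.
Qed.

(** A central companion cancels from the pseudo-automorphism identity. *)
Lemma lam_morph x y : comm x y \in Z -> {morph lam x y : u v / u ** v}.
Proof.
move=> cZ u v; have cZ' : comm y x \in Z by rewrite comm_inv cenV.
apply: (@rmulI _ (comm y x)); rewrite /= lam.unlock.
by rewrite -(pseudo_innR y x u v) cen_assoc.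
Qed.

Lemma morph_ltrans f x : {morph f : u v / u ** v} -> L x ^ f = L (f x).
Proof.
move=> fM; apply/permP=> u; rewrite conjgE !permM !ltransE fM.
by rewrite -permM mulVg perm1.
Qed.

Lemma morph_rtrans f x : {morph f : u v / u ** v} -> R x ^ f = R (f x).
Proof.
move=> fM; apply/permP=> u; rewrite conjgE !permM !rtransE fM.
by rewrite -permM mulVg perm1.
Qed.

Lemma Inn_cen_eq f g ze :
  f \in Inn Q -> g \in Inn Q -> f = g * R ze -> f = g.
Proof.
move=> fI gI e; have := congr1 (fun h : {perm Q} => h 1l) e.
rewrite permM (Inn1 fI) (Inn1 gI) rtransE lmul1 => z1; rewrite e -z1.
by apply/permP=> u; rewrite permM rtransE lmulr1.
Qed.

Lemma Z2_lam_R d x y : Z2 d -> exists2 ze, ze \in Z &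
  lam d x * R y = R y * lam d x * R ze.
Proof.
move=> dZ; have [ze zeZ e] := Z2_lam x y dZ; exists (linv ze); first exact: cenV.
apply/permP=> u; rewrite !permM !rtransE (lam_morph (Z2_comm _ dZ)) e.
by rewrite (cen_assoc _ _ zeZ) rmulK.
Qed.

Lemma Z2_lam_L d x y : Z2 d -> exists2 ze, ze \in Z &
  lam d x * L y = L y * lam d x * R ze.
Proof.
move=> dZ; have [ze zeZ e] := Z2_lam x y dZ; exists (linv ze); first exact: cenV.
apply/permP=> u; rewrite !permM !rtransE !ltransE (lam_morph (Z2_comm _ dZ)) e.
by rewrite (cen_swap _ _ zeZ) rmulK.
Qed.

(** Expand L (x ** d) as lam d x * L d * L x and move R y to the left.  All the
associators involving d commute with translations up to central ones; the
total central factor is trivial since both sides fix 1. *)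
Lemma lam_mull_Z2 x d y : Z2 d -> lam (x ** d) y = lam x y * lam d y.
Proof.
move=> dZ.
(* z1 and z2 measure the failure of associators with d to commute with R y and
   L x. *)
have [z1 z1Z e1] := Z2_lam_R x y dZ; have [z2 z2Z e2] := Z2_lam_L y x dZ.
rewrite (InnC (lam_in x y) (lam_in d y)).
suff [ze e] : exists ze, lam (x ** d) y = lam d y * lam x y * R ze.
  by apply: Inn_cen_eq e; rewrite ?groupM ?lam_in.
exists (z1 ** z2).
have LE : L (x ** d) = lam d x * (L d * L x).
  by rewrite ltransM mulgA lamV mulVg mul1g.
have RE : R (z1 ** z2) = R z1 * R z2.
  by apply/permP=> u; rewrite permM !rtransE cen_assoc.
have lamLR a b : L a * R b = R b * L a * lam a b.
  by rewrite ltrans_rtrans; apply: commuteM; [apply: lam_Rr | apply: lam_Ll].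
apply: (mulgI (R y * L (x ** d))); rewrite -lamLR.
rewrite {}RE {}LE.
have c1L u : commute (R z1) (L u) by apply: cen_RL.
have c1I f : f \in Inn Q -> commute (R z1) f by apply: cen_RI.
have c2I f : f \in Inn Q -> commute (R z2) f by apply: cen_RI.
transitivity (R y * lam d x * R z1 * L d * (L x * lam d y * R z2) * lam x y).
  rewrite -!mulgA [L x * R y]lamLR !mulgA -e1.
  rewrite -!mulgA [L d * (R y * _)]mulgA [L d * R y]lamLR !mulgA.
  by rewrite -[_ * lam d y * L x]mulgA e2 !mulgA.
rewrite -!mulgA; congr (_ * (_ * _)).
rewrite (c2I _ (lam_in x y)) mulgA c1L -!mulgA; congr (_ * _).
rewrite mulgA c1L -!mulgA; congr (_ * _).
rewrite mulgA (c1I _ (lam_in d y)) -mulgA [R z1 * (lam x y * _)]mulgA.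
by rewrite (c1I _ (lam_in x y)) -mulgA.
Qed.

Lemma lam_mulr_Z2 x y d : Z2 d -> lam x (y ** d) = lam x y * lam x d.
Proof.
by move=> dZ; rewrite lamV lam_mull_Z2 // invMg -!(lamV _ x) InnC ?lam_in.
Qed.

Lemma lam_mul_cen x ze y : ze \in Z -> lam (x ** ze) y = lam x y.
Proof. by move=> zeZ; rewrite (lam_mull_Z2 _ _ (Z2_cen zeZ)) (cen_lam _ zeZ) mulg1. Qed.

Definition delta f x := linv x ** f x.

Lemma deltaE f x : f x = x ** delta f x.
Proof. by rewrite lmulK. Qed.

(** The loop modulo its center has nilpotency class at most two. *)
Hypothesis deltaZ2 : forall x f, f \in Inn Q -> Z2 (delta f x).

(** * Commutators in class three *)

Lemma comm_Z2 x y : Z2 (comm x y).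
Proof. by have := deltaZ2 x (innT_in y); rewrite /delta innT_comm lmulKV. Qed.

Lemma comm_linv d y : Z2 d -> comm (linv d) y = linv (comm d y).
Proof.
move=> dZ; apply: (@lmulI _ (linv d)); rewrite /= -innT_comm Inn_linv ?innT_in //.
by rewrite innT_comm linvM cenC // cenV // Z2_comm.
Qed.

Lemma innT_sym x y : T x y = y -> T y x = x.
Proof.
by move=> e; apply: (@lmulI _ y); rewrite /= innTE -[RHS]innTE e.
Qed.

Lemma lam_comml x y : lam (comm x y) x = 1.
Proof. by rewrite lamV comm_inv lamV_r invgK lam_commr. Qed.

Lemma ltrans_innT_cube x y : L x ^ T y = lam x y ^+ 3 * L (T y x).
Proof. by rewrite ltrans_innT [lam (T y x) y]lamV lam_innT -lamV -expgSr. Qed.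

Lemma innT_lmulE y z u : T y (z ** u) = T y z ** (lam z y ^+ 3) (T y u).
Proof.
have := congr1 (fun g : {perm Q} => g (T y u)) (ltrans_innT_cube z y).
rewrite conjgE (permM (T y)^-1) permK (permM (L z)) (permM (lam z y ^+ 3)).
by rewrite !ltransE.
Qed.

(** The commutators of z have no associators with z, so that the products may be
regrouped. *)
Lemma innT_innT z x y :
  T y (T x z) = (z ** (comm z y ** comm z x)) ** comm (comm z x) y.
Proof.
set d := comm z x; set e := comm z y.
have ld : lam d z = 1 by apply: lam_comml.
have le : lam e z = 1 by apply: lam_comml.
rewrite [T x z]innT_comm -/d innT_lmulE innT_comm -/e innT_comm.
have cdZ : comm d y \in Z by apply/Z2_comm/comm_Z2.
have ldz : lam z y d = d by do 2!apply: lam_fix_cyc; rewrite ld perm1.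
rewrite Inn_fixMr ?groupX ?lam_in ?perm_fixX //; last first.
  by rewrite cen_fix ?groupX ?lam_in.
rewrite (cen_assoc _ _ cdZ) (@lam_assoc d e z) //.
by apply: lam_fix_cyc; rewrite le perm1.
Qed.

Lemma comm_comm_sym z x y : comm (comm z x) y = comm (comm z y) x.
Proof.
set d := comm z x; set e := comm z y.
have ed : e ** d = d ** e.
  have Tez : T e z = z by apply: innT_sym; apply: innT_fix_comml.
  have Ted : T e d = d.
    rewrite -(lmulKV z d) -innT_comm Inn_fixM ?Inn_fixV ?innT_in //.
    by rewrite -permM InnC ?innT_in // permM Tez.
  by rewrite -(innTE e d) Ted.
have : T y (T x z) = T x (T y z) by rewrite -!permM InnC ?innT_in.
by rewrite !innT_innT -/d -/e ed => /lmulI.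
Qed.

(** Comparing the values of T y (T x z) and T x (T y z) shows that the triple
commutator is symmetric in its last two arguments; it is alternating in the
first two. *)
Lemma comm_comm x y z : comm (comm x y) z = 1l.
Proof.
apply: lmul_sq1.
have alt u v w : comm (comm v u) w = linv (comm (comm u v) w).
  by rewrite [comm v u]comm_inv comm_linv //; apply: comm_Z2.
have e := alternating_symmetric linvK alt _ x y z; rewrite {1}e ?lmulVl // => u v w.
by rewrite alt comm_comm_sym -alt comm_comm_sym.
Qed.

Lemma innT_of_comm_eq1 x y : T (comm x y) = 1.
Proof.
apply/permP=> u; rewrite perm1; apply: innT_sym.
by rewrite innT_comm comm_comm lmulr1.
Qed.

(** The sixth power is the T-mapping of a commutator, which is now trivial, and
there is no 2-torsion. *)
Lemma lam_cube x y : lam x y ^+ 3 = 1.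
Proof.
by rewrite -lamX; apply: lam_sq1; rewrite lamX -expgM -innT_of_comm innT_of_comm_eq1.
Qed.

Lemma innT_morph y : {morph T y : u v / u ** v}.
Proof.
by move=> u v; rewrite innT_lmulE lam_cube perm1.
Qed.

(** * Associators of commutators *)

Lemma lam_morph_inv f x y : f \in Inn Q -> {morph f : u v / u ** v} ->
  lam (f x) (f y) = lam x y.
Proof.
move=> fI fM; apply: (mulIg (L (f x))).
rewrite -lam_conj -morph_ltrans // -morph_rtrans // -conjJg lam_conj.
by rewrite (conjMg (lam x y)) (Inn_conj (lam_in x y) fI).
Qed.

(** An automorphism f commuting with the associator mappings satisfies
lam (f x) y = lam x (f^-1 y).  Expanding both sides, where f^-1 displaces y by
the inverse of delta f y modulo the center, gives the symmetry. *)
Lemma lam_delta_sym f x y : f \in Inn Q -> {morph f : u v / u ** v} ->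
  lam (delta f x) y = lam (delta f y) x.
Proof.
move=> fI fM; pose y0 := f^-1 y; have fy0 : f y0 = y by rewrite permKV.
have dE : f (delta f y0) = delta f y by rewrite fM Inn_linv // fy0.
have [ze zeZ] := deltaZ2 y0 fI fI; rewrite dE => ->.
rewrite (lam_mul_cen _ _ zeZ) [RHS]lamV.
have e1 : lam x y = lam x y0 * lam x (delta f y0).
  by rewrite -lam_mulr_Z2 -?deltaE ?fy0 //; apply: deltaZ2.
have e2 : lam x y0 = lam x y * lam (delta f x) y.
  by rewrite -lam_mull_Z2 -?deltaE; [rewrite -[in RHS]fy0 lam_morph_inv | apply: deltaZ2].
apply: (mulgI (lam x (delta f y0))); rewrite mulgV.
by apply: (mulgI (lam x y0)); rewrite mulgA -e1 -e2 mulg1.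
Qed.

Lemma lam_comm_eq1 x y z : lam (comm x y) z = 1.
Proof.
have dT u v : delta (T v) u = comm u v by rewrite /delta innT_comm lmulKV.
apply: lam_sq1; rewrite expgS expg1.
rewrite {1}(@alternating_symmetric _ _ invg (fun x y z => lam (comm x y) z)
  (@invgK _)) ?mulVg //.
  by move=> u v w; rewrite [comm v u]comm_inv lamV_l.
move=> u v w; rewrite -!dT; apply: lam_delta_sym; first exact: innT_in.
exact: innT_morph.
Qed.

Lemma lam_eq1_fix k u v : (forall w, lam k w = 1) -> lam u v k = k.
Proof. by move=> k1; do 2!apply: lam_fix_cyc; rewrite k1 perm1. Qed.

Lemma center_of_fixed k : (forall w, lam k w = 1) -> (forall w, T w k = k) -> k \in Z.
Proof.
move=> k1 k2; apply/loop_centerP=> f; elim/Inn_gen: f /.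
- by rewrite perm1.
- by move=> f g _ _ fk gk; rewrite permM fk.
- exact: k2.
- by move=> u v; apply: lam_eq1_fix.
Qed.

Lemma comm_cen x y : comm x y \in Z.
Proof.
apply: center_of_fixed => w; first exact: lam_comm_eq1.
by rewrite innT_comm comm_comm lmulr1.
Qed.

(** * Associators in class three *)

Lemma Z2_slide x d w : Z2 d -> exists2 ze, ze \in Z &
  (x ** d) ** w = (x ** (w ** d)) ** ze.
Proof.
move=> dZ; have [z1 z1Z /(lam_disp_cyc z1Z) e1] := Z2_lam x w dZ.
have [z2 z2Z e2] := dZ _ (innT_in w).
exists (z1 ** z2); first exact: loop_centerM.
rewrite -(lamE w d x) e1 -(innTE w d) e2 (cen_swap _ _ z1Z) !(cen_assoc _ _ z2Z).
by rewrite -!(cenC _ z2Z) !(cen_assoc _ _ z1Z).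
Qed.

Lemma Z2_assoc x y d : Z2 d -> exists2 ze, ze \in Z &
  x ** (y ** d) = ((x ** y) ** d) ** ze.
Proof.
move=> dZ; have [z zZ e] := Z2_lam y x dZ; exists (linv z); first exact: cenV.
by rewrite -(lamE d y x) e (cen_swap _ _ zZ) rmulK.
Qed.

(** Modulo the center delta (lam u v) x is an associator of u, v and x.  It
changes sign when u and v are exchanged, lam v u being the inverse of lam u v,
and it is invariant under cyclic rotation by the commutation rule for L x and
R v. *)
Lemma lam_delta_alt v x u y :
  lam (delta (lam x v) u) y = (lam (delta (lam u v) x) y)^-1.
Proof.
have dZ a b c : Z2 (delta (lam a b) c) by apply/deltaZ2/lam_in.
set d := delta (lam u v) x; set e := delta (lam x v) u.
pose d' := delta (lam v u) x.
have -> : lam d y = (lam d' y)^-1.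
  have [ze zeZ e1] := dZ v u x _ (lam_in u v).
  have E : (x ** d) ** (d' ** ze) = x.
    rewrite -e1 -[x ** d]deltaE -(lam_morph (comm_cen _ _)) -deltaE.
    by rewrite (lamV u v) permKV.
  have -> : d = linv (d' ** ze).
    by apply: (@lmulI _ x); rewrite /= -{2}E rmulK.
  by rewrite lamV_l (lam_mul_cen _ _ zeZ).
rewrite invgK.
have E : (x ** d') ** (u ** v) = x ** ((u ** e) ** v).
  rewrite -!deltaE lamE.
  have := congr1 (fun g : {perm Q} => g u) (ltrans_rtrans x v).
  by rewrite (permM (L x)) (permM (lam x v)) (permM (R v)) !(ltransE, rtransE).
move: (dZ v u x) (dZ x v u) E; rewrite -/d' -/e.
(* Both sides are brought to the form x((uv)d) with d adjusted by a central
   factor. *)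
move: (d') (e) => {dZ d e}d' e {}d'Z eZ.
have [z1 z1Z e1] := Z2_slide x (u ** v) d'Z.
have [z2 z2Z e2] := Z2_slide u v eZ.
have [z3 z3Z e3] := Z2_assoc u v eZ.
rewrite e1 e2 e3 -!(cen_assoc _ _ z1Z) -!(cen_assoc _ _ z3Z) -!(cen_assoc _ _ z2Z).
move=> /lmulI/lmulI/(congr1 (fun a => lam a y)).
by rewrite (lam_mul_cen _ _ z1Z) (lam_mul_cen _ _ (loop_centerM z3Z z2Z)).
Qed.

Lemma lam_delta_eq1 u v x y : lam (delta (lam u v) x) y = 1.
Proof.
apply: lam_sq1; rewrite expgS expg1.
rewrite {1}(@alternating_symmetric _ _ invg
  (fun x u y => lam (delta (lam u v) x) y) (@invgK _)) ?mulVg //.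
  by move=> a b c; apply: lam_delta_alt.
move=> a b c; apply: lam_delta_sym; first exact: lam_in.
exact/lam_morph/comm_cen.
Qed.

(** The automorphism f = lam u v commutes with T x, so T (f x) = T x: the points
f x and x have the same commutators with w.  As T w is an automorphism, the
quotient delta f x commutes with w. *)
Lemma innT_delta u v x w : T w (delta (lam u v) x) = delta (lam u v) x.
Proof.
set f := lam u v; have fM : {morph f : a b / a ** b} by apply/lam_morph/comm_cen.
have Tf : T (f x) = T x.
  rewrite -[RHS](@Inn_conj _ f) ?innT_in ?lam_in // /innT.
  by rewrite (conjMg (R x)) conjVg morph_ltrans // morph_rtrans.
(* T (f x) determines the commutators with f x only in the other order. *)
have kE : comm (f x) w = comm x w.
  rewrite ![comm _ w]comm_inv; congr linv; apply: (@lmulI _ w).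
  by rewrite /= -!innT_comm Tf.
have := innT_comm (f x) w; rewrite kE (deltaE f x) innT_morph (innT_comm x w).
by rewrite !(cen_swap _ _ (comm_cen x w)) => /rmulI/lmulI.
Qed.

Lemma Inn_central_disp x f : f \in Inn Q -> exists2 ze, ze \in Z & f x = x ** ze.
Proof.
move=> fI; move: f fI x; apply: Inn_gen => [|f g fI gI fP gP|y|u v] x.
- by exists 1l; rewrite ?loop_center1 // perm1 lmulr1.
- have [z1 z1Z e1] := fP x; have [z2 z2Z e2] := gP x.
  exists (z2 ** z1); first exact: loop_centerM.
  by rewrite permM e1 Inn_fixMr // ?e2 ?cen_fix // cen_assoc.
- by exists (comm x y); rewrite ?comm_cen // innT_comm.
- exists (delta (lam u v) x); last exact: deltaE.
  by apply: center_of_fixed => w; [apply: lam_delta_eq1 | apply: innT_delta].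
Qed.

End Moufang.

(** * Quotients and the induction *)

Section Quotient.

Variables (Q : finLoopType) (N : normal_subloop Q).
Local Notation pi := (@loop_coset Q N).

Lemma loop_coset_eq x y : pi x = pi y -> exists2 n, n \in N & x = y ** n.
Proof.
move/(congr1 (fun A : loop_quotient N => A : {set Q})) => /= e.
by have := lcoset_mem N x; rewrite e => /imsetP.
Qed.

Lemma loop_coset_mulr x n : n \in N -> pi (x ** n) = pi x.
Proof.
by move=> nN; apply: val_inj => /=; apply: lcoset_sub; apply: imset_f.
Qed.

Lemma Inn_quotient_lift psi : psi \in Inn (loop_quotient N) ->
  exists2 phi, phi \in Inn Q & forall x, pi (phi x) = psi (pi x).
Proof.
elim/Inn_ind: psi /.
- by exists 1; rewrite ?group1 // => x; rewrite !perm1.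
- move=> s t [s' s'I sE] [t' t'I tE]; exists (s' * t'); first exact: groupM.
  by move=> x; rewrite !permM tE sE.
- move=> A; have [y ->] := loop_coset_surj A.
  exists (innT y); first exact: innT_in.
  by move=> x; apply: (@lmulI _ (pi y)); rewrite /= innTE -!loop_cosetM innTE.
- move=> A B; have [y ->] := loop_coset_surj A; have [z ->] := loop_coset_surj B.
  exists (innL y z); first exact: innL_in.
  move=> x; apply: (@lmulI _ (pi z ** pi y)).
  by rewrite /= innLE -!loop_cosetM innLE.
- move=> A B; have [y ->] := loop_coset_surj A; have [z ->] := loop_coset_surj B.
  exists (innR y z); first exact: innR_in.
  move=> x; apply: (@rmulI _ (pi y ** pi z)).
  by rewrite /= innRE -!loop_cosetM innRE.
Qed.

Lemma preim_centerP x :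
  reflect (forall f, f \in Inn Q -> exists2 n, n \in N & f x = x ** n)
          (x \in preim_center N).
Proof.
rewrite mem_preim_center; apply: (iffP (loop_centerP _)) => h.
  move=> f fI; have [psi psiI e] := Inn_coset N fI.
  by apply: loop_coset_eq; rewrite e h.
move=> psi psiI; have [f fI e] := Inn_quotient_lift psiI.
by have [n nN fx] := h f fI; rewrite -e fx loop_coset_mulr.
Qed.

Lemma moufang_quotient : moufang Q -> moufang (loop_quotient N).
Proof.
move=> mfg A B C; have [x ->] := loop_coset_surj A.
have [y ->] := loop_coset_surj B; have [z ->] := loop_coset_surj C.
by rewrite -!loop_cosetM mfg.
Qed.

Lemma odd_quotient : (forall x : Q, odd #[ltrans x]) ->
  forall A : loop_quotient N, odd #[ltrans A].
Proof.
move=> oQ A; have [x ->] := loop_coset_surj A; apply: dvdn_odd (oQ x).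
rewrite order_dvdn; apply/eqP/permP=> B; have [y ->] := loop_coset_surj B.
rewrite perm1 -[in RHS](perm1 y) -(expg_order (ltrans x)) !permX.
by elim: #[_] => //= n ->; rewrite !ltransE loop_cosetM.
Qed.

Lemma abelian_quotient : abelian (Inn Q) -> abelian (Inn (loop_quotient N)).
Proof.
move=> abQ; apply/centsP=> s sI t tI.
have [f fI fE] := Inn_quotient_lift sI; have [g gI gE] := Inn_quotient_lift tI.
apply/permP=> A; have [x ->] := loop_coset_surj A.
by rewrite !permM -fE -gE -gE -fE -!permM (centsP abQ f fI g gI).
Qed.

Lemma card_quotient_lt n : n \in N -> n != lone -> #|{: loop_quotient N}| < #|Q|.
Proof.
move=> nN n1; have surj : codom pi =i predT.
  by move=> A; have [x ->] := loop_coset_surj A; rewrite codom_f.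
rewrite -(eq_card surj) ltn_neqAle leq_image_card andbT.
apply/negP => /image_injP inj; case/eqP: n1; apply: inj => //.
by rewrite -(lmul1 n) loop_coset_mulr.
Qed.

End Quotient.

Lemma iter_center1 (Q : finLoopType) x :
  (x \in iter_center Q 1) = (x \in loop_center Q).
Proof.
apply/preim_centerP/loop_centerP => h f fI.
  by have [n /set1P-> ->] := h f fI; rewrite lmulr1.
by exists lone; rewrite ?set11 // lmulr1 h.
Qed.

(** Induction on the order: the quotient by the center has class at most two, so
that displacements lie in the second center.  Oddness is expressed through the
orders of left translations, which can only shrink to divisors in quotients. *)
Lemma abelian_Inn_class2 (Q : finLoopType) : moufang Q ->
  (forall x : Q, odd #[ltrans x]) -> abelian (Inn Q) ->
  iter_center Q 2 = [set: Q] :> {set Q}.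
Proof.
have [m] := ubnP #|Q|; elim: m Q => // m IHm Q leQm mfg oddQ abQ.
have [Q1 | ] := boolP [forall x : Q, x == lone].
  apply/setP=> x; rewrite in_setT (eqP (forallP Q1 x)).
  exact: (nsub1 (iter_center Q 2)).
case/forallPn=> x x1.
have [z zZ z1] := center_nontrivial mfg oddQ abQ x1.
pose N := iter_center Q 1.
have zN : z \in N by rewrite iter_center1.
have IH : iter_center (loop_quotient N) 2 = [set: loop_quotient N] :> {set _}.
  apply: IHm; first exact: leq_trans (card_quotient_lt zN z1) leQm.
  - exact: moufang_quotient.
  - exact: odd_quotient.
  - exact: abelian_quotient.
have deltaZ2 y f : f \in Inn Q -> Z2 (delta f y).
  move=> fI; have [psi psiI e] := Inn_coset N fI.
  have /preim_centerP/(_ psi psiI)[w wZ pw] :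
      loop_coset N y \in iter_center (loop_quotient N) 2.
    by rewrite IH inE.
  have dw : loop_coset N (linv y ** f y) = w.
    apply: (@lmulI _ (loop_coset N y)).
    by rewrite /= -pw -e -loop_cosetM (lmulK mfg).
  have : linv y ** f y \in preim_center N.
    by rewrite mem_preim_center dw -iter_center1.
  move/preim_centerP=> h g gI; have [n nN ->] := h g gI.
  by exists n; rewrite // -iter_center1.
apply/setP=> y; rewrite in_setT; apply/preim_centerP=> f fI.
have [n nZ ->] := Inn_central_disp mfg oddQ abQ deltaZ2 y fI.
by exists n; rewrite // iter_center1.
Qed.

Theorem theorem4p1 (Q : finLoopType) (hmoufang : moufang Q)
  (hodd : odd #|Q|) (hab : abelian (Inn Q)) :
  exists m : nat, nilpotent_of_class Q m /\ m <= 2.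
Proof.
have cl2 : exists m, (iter_center Q m : {set Q}) == [set: Q].
  exists 2; apply/eqP/abelian_Inn_class2 => // x; exact: odd_ltrans.
case: (ex_minnP cl2) => m /eqP mE m_min; exists m; split; last first.
  by apply/m_min/eqP/abelian_Inn_class2 => // x; exact: odd_ltrans.
by split=> // k /eqP; apply: m_min.
Qed.
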